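(* Let $G=(V,E)$ be an infinite, connected graph of bounded degree. If $p_0\in(0,1)$ is such that \[ \lim_{n\to\infty}\max\bigl\{\mathbb P_{p_0}(A\nleftrightarrow B):A,B\subseteq V,\ |A|,|B|\ge n\bigr\}=0, \] then Bernoulli-$p$ bond percolation on $G$ has a unique infinite cluster almost surely for every $p>p_0$.
   Context: $\mathbb P_p$ is the law of Bernoulli-$p$ bond percolation on $G$ (each edge open independently with probability $p$). $\{A\leftrightarrow B\}$ is the event that some open path connects a vertex of $A$ to a vertex of $B$, and $\{A\nleftrightarrow B\}$ is its complement. (The sets $A,B$ in the maximum may be taken finite.) *)

(* Defs.v *)
From HB Require Import structures.
From Stdlib Require Import Relation_Operators.
From mathcomp Require Import all_boot all_order all_algebra.
From mathcomp Require Import all_classical all_reals all_analysis.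



Unset Printing Implicit Defensive.

Import Order.TTheory GRing.Theory Num.Theory.
Local Open Scope classical_set_scope.
Local Open Scope ring_scope.

(* A simple graph on a countable vertex type [V] is given by a symmetric,
   irreflexive adjacency relation [adj].  Each (undirected) edge {x,y} is
   represented exactly once, as the ordered pair (x,y) with
   pickle x < pickle y. *)
Definition edge {V : countType} (adj : rel V) : Type :=
  {e : V * V | adj e.1 e.2 && (pickle e.1 < pickle e.2)%N}.

(* Bond configurations: each edge is open (true) or closed (false). *)
Definition config {V : countType} (adj : rel V) : Type := edge adj -> bool.

(* The product sigma-algebra on configurations is generated by the
   coordinate events {w | w e = true}. *)
Definition coord_events {V : countType} (adj : rel V) : set (set (config adj)) :=
  [set [set w : config adj | w e = true] | e in [set: edge adj]].

Definition Omega {V : countType} (adj : rel V) :=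
  g_sigma_algebraType (coord_events adj).

(* [P] is the law of Bernoulli-p bond percolation: the edge states are
   independent, each open with probability p (finite-dimensional
   distributions of the product measure). *)
Definition is_bernoulli_percolation {V : countType} {adj : rel V}
  {R : realType} (p : R) (P : probability (Omega adj) R) : Prop :=
  forall (s : seq (edge adj)) (sigma : edge adj -> bool), uniq s ->
    P [set w : Omega adj | forall e, e \in s -> w e = sigma e] =
    (\prod_(e <- s) (if sigma e then p else 1 - p))%:E.

Definition open_adj {V : countType} {adj : rel V} (w : config adj) (x y : V) : Prop :=
  exists e : edge adj, w e = true /\ (val e = (x, y) \/ val e = (y, x)).

Definition open_connected {V : countType} {adj : rel V} (w : config adj) (x y : V) : Prop :=
  clos_refl_trans V (open_adj w) x y.

Definition connects {V : countType} {adj : rel V} (w : config adj) (A B : seq V) : Prop :=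
  exists a b, a \in A /\ b \in B /\ open_connected w a b.

Definition cluster {V : countType} {adj : rel V} (w : config adj) (x : V) : set V :=
  [set y | open_connected w x y].

Definition unique_infinite_cluster {V : countType} {adj : rel V} (w : config adj) : Prop :=
  (exists x, infinite_set (cluster w x)) /\
  (forall x y, infinite_set (cluster w x) -> infinite_set (cluster w y) ->
     open_connected w x y).

(* Main.v *)
Require Import Defs.
From HB Require Import structures.
From Stdlib Require Import Relation_Operators Operators_Properties.
From mathcomp Require Import all_boot all_order all_algebra.
From mathcomp Require Import all_classical all_reals all_analysis.
From mathcomp Require Import ring lra.

Import Order.TTheory GRing.Theory Num.Theory.
Local Open Scope classical_set_scope.
Local Open Scope ring_scope.

(* Write the Bernoulli-p configuration as w0 | w1 | w2, with w0 Bernoulli-p0 and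
   w1, w2 independent sprinklings.  Given finite sets A and B, the edges leaving
   A towards a vertex joined to B off A are determined by the states of the edges
   not touching A.  Resampling the edges touching A therefore shows that there are
   many such edges with high probability, since otherwise A and B would be
   disconnected with non-negligible probability; hence A and B stay connected when
   the edges touching one of them are replaced by a sparse sprinkling.

   Let B be the (local) cluster of y in w0, and T the set of vertices joined to B
   by w0 off B together with w1 on the edges touching B.  If the cluster A of x in
   w is large, then w0 off A is independent of A, so many edges join A to T.
   Given w0 and w1, the set T is fixed, and whether x is joined to T is decided by
   the w2-states of the edges between T and the cluster of x off T: each of the
   many edges gives an independent chance.  So every infinite p-cluster contains
   every infinite p0-cluster, and the latter exist because a large set is joined
   to sets arbitrarily far away.

   All estimates are carried out for finitely many edges, where expectations are
   finite sums, and transferred to the percolation measures by continuity. *)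

(** * Indicator functions of propositions *)

Section Indicator.
Context {R : realType}.
Implicit Types P Q : Prop.

Definition ind P : R := (`[< P >])%:R.

Lemma ind1 P : P -> ind P = 1.
Proof. by move=> h; rewrite /ind asboolT. Qed.

Lemma ind0 P : ~ P -> ind P = 0.
Proof. by move=> h; rewrite /ind asboolF. Qed.

Lemma ind_ge0 P : 0 <= ind P.
Proof. exact: ler0n. Qed.

Lemma ind_le1 P : ind P <= 1.
Proof. by rewrite /ind; case: `[< _ >]. Qed.

Lemma ind_le P Q : (P -> Q) -> ind P <= ind Q.
Proof.
move=> h; case: (pselect P) => hP; first by rewrite !ind1 //; apply: h.
by rewrite ind0 // ind_ge0.
Qed.

Lemma ind_eq P Q : (P <-> Q) -> ind P = ind Q.
Proof. by move=> h; congr ind; apply: propext. Qed.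

Lemma ind_leD P Q S : (P -> Q \/ S) -> ind P <= ind Q + ind S.
Proof.
move=> h; case: (pselect P) => hP; last by rewrite ind0 // addr_ge0 ?ind_ge0.
by case: (h hP) => hQ; rewrite (ind1 _ hP) (ind1 _ hQ) ?lerDl ?lerDr ind_ge0.
Qed.

Lemma indM P Q : ind (P /\ Q) = ind P * ind Q.
Proof.
case: (pselect P) => hP; last by rewrite !(ind0 P) // mul0r ind0 // => -[].
by rewrite (ind1 P) // mul1r; apply: ind_eq; split=> [[]|].
Qed.

End Indicator.

(** * Expectations under finite product measures *)

Section Expectation.
Context {R : realType} {I : eqType}.
Implicit Types (r : I -> R) (s : seq I) (w : I -> bool) (f g : (I -> bool) -> R).

Definition upd w i b : I -> bool := fun j => if j == i then b else w j.

(* Expectation of [f] when the coordinates [i] in [s] are independent and true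
   with probability [r i], all other coordinates being false. *)
Fixpoint Ex r s f : R :=
  if s is i :: s' then
    r i * Ex r s' (fun w => f (upd w i true))
    + (1 - r i) * Ex r s' (fun w => f (upd w i false))
  else f (fun=> false).

Definition supp w s := forall i, w i -> i \in s.

Definition is_prob r := forall i, 0 <= r i <= 1.

Lemma supp_upd w s i b : supp w s -> supp (upd w i b) (i :: s).
Proof.
by move=> h j; rewrite /upd inE; case: eqP => //= _ /h.
Qed.

Lemma Ex_le r s f g : is_prob r ->
  (forall w, supp w s -> f w <= g w) -> Ex r s f <= Ex r s g.
Proof.
move=> hr; elim: s f g => [|i s IH] f g h /=; first exact: h.
have /andP[h0 h1] := hr i.
by apply: lerD; apply: ler_wpM2l; rewrite ?subr_ge0 //; apply: IH => w hw;
  apply: h; apply: supp_upd.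
Qed.

Lemma Ex_eq r s f g :
  (forall w, supp w s -> f w = g w) -> Ex r s f = Ex r s g.
Proof.
elim: s f g => [|i s IH] f g h /=; first exact: h.
by congr (_ * _ + _ * _); apply: IH => w hw; apply: h; apply: supp_upd.
Qed.

Lemma Ex_cst r s (c : R) : Ex r s (fun=> c) = c.
Proof. by elim: s => //= i s ->; ring. Qed.

Lemma ExD r s f g : Ex r s (fun w => f w + g w) = Ex r s f + Ex r s g.
Proof. by elim: s f g => //= i s IH f g; rewrite !IH; ring. Qed.

Lemma ExZ r s (c : R) f : Ex r s (fun w => c * f w) = c * Ex r s f.
Proof. by elim: s f => //= i s IH f; rewrite !IH; ring. Qed.

Lemma ExZr r s (c : R) f : Ex r s (fun w => f w * c) = Ex r s f * c.
Proof. by rewrite mulrC -ExZ; apply: Ex_eq => w _; rewrite mulrC. Qed.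

Lemma Ex_sum r s (T : eqType) (l : seq T) (F : T -> (I -> bool) -> R) :
  Ex r s (fun w => \sum_(t <- l) F t w) = \sum_(t <- l) Ex r s (F t).
Proof.
elim: l => [|t l IH].
  by rewrite big_nil -[RHS](Ex_cst r s); apply: Ex_eq => w _; rewrite big_nil.
rewrite big_cons -IH -ExD; apply: Ex_eq => w _; exact: big_cons.
Qed.

Lemma Ex_exchange r r' s s' (F : (I -> bool) -> (I -> bool) -> R) :
  Ex r s (fun w => Ex r' s' (fun w' => F w w')) =
  Ex r' s' (fun w' => Ex r s (fun w => F w w')).
Proof. by elim: s F => //= i s IH F; rewrite ExD !ExZ !IH. Qed.

(** Two independent product fields combined coordinatewise form a product field again; [r i]
    collects the weights of the pairs on which [g i] is true. Resampling and sprinkling are both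
    instances. The condition on [g i false false] matches the convention that coordinates outside
    [s] are false. *)
Lemma Ex_combine (g : I -> bool -> bool -> bool) r1 r2 r s f :
  (forall i, g i false false = false) ->
  (forall i, r i = r1 i * r2 i * (g i true true)%:R
     + r1 i * (1 - r2 i) * (g i true false)%:R
     + (1 - r1 i) * r2 i * (g i false true)%:R) ->
  Ex r1 s (fun w1 => Ex r2 s (fun w2 => f (fun i => g i (w1 i) (w2 i)))) =
  Ex r s f.
Proof.
move=> g0 hr; elim: s f => [|i s IH] f /=.
  by congr f; apply: funext => i; rewrite g0.
have E b1 b2 : Ex r1 s (fun w1 => Ex r2 s (fun w2 =>
     f (fun j => g j (upd w1 i b1 j) (upd w2 i b2 j)))) =
     Ex r s (fun w => f (upd w i (g i b1 b2))).
  rewrite -IH; apply: Ex_eq => w1 _; apply: Ex_eq => w2 _; congr f.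
  by apply: funext => j; rewrite /upd; case: eqP => [->|].
rewrite !ExD !ExZ !E hr g0.
by case: (g i true true); case: (g i true false); case: (g i false true) => /=;
  ring.
Qed.

Lemma Ex_all_false r s (F : pred I) : uniq s ->
  Ex r s (fun w => (all (fun i => F i ==> ~~ w i) s)%:R) =
  \prod_(i <- s | F i) (1 - r i).
Proof.
elim: s => [|i s IH] /=; first by rewrite big_nil.
move=> /andP[iNs us].
have E b : Ex r s (fun w => ((F i ==> ~~ upd w i b i) &&
    all (fun j => F j ==> ~~ upd w i b j) s)%:R) =
    (F i ==> ~~ b)%:R * \prod_(j <- s | F j) (1 - r j).
  rewrite -IH // -ExZ; apply: Ex_eq => w _; rewrite -natrM mulnb.
  congr ((_ && _)%:R); first by rewrite /upd eqxx.
  apply: eq_in_all => j js; rewrite /upd; case: eqP => // ji.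
  by rewrite -ji js in iNs.
rewrite !E big_cons; case: (F i) => /=; ring.
Qed.

(** Only finitely many configurations are supported on [s]. This permits sums over all possible
    values of a random cluster. *)
Lemma supp_range (T : eqType) s (K : (I -> bool) -> T) :
  exists l : seq T, uniq l /\ forall w, supp w s -> K w \in l.
Proof.
suff [l hl] : exists l : seq T, forall w, supp w s -> K w \in l.
  by exists (undup l); split=> [|w /hl]; rewrite ?undup_uniq ?mem_undup.
elim: s K => [|i s IH] K.
  exists [:: K (fun=> false)] => w hw; rewrite inE; apply/eqP; congr K.
  by apply: funext => i; apply/negP => /hw.
have [l1 h1] := IH (fun w => K (upd w i true)).
have [l2 h2] := IH (fun w => K (upd w i false)).
exists (l1 ++ l2) => w hw; rewrite mem_cat.
have hw' : supp (upd w i false) s.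
  by move=> j; rewrite /upd; case: eqP => // ji /hw; rewrite inE => /orP[/eqP|].
have E : w = upd (upd w i false) i (w i).
  by apply: funext => j; rewrite /upd; case: eqP => // ->.
by rewrite E; case: (w i); rewrite ?(h1 _ hw') ?(h2 _ hw') ?orbT.
Qed.

Lemma sum_ind_eq (T : eqType) (l : seq T) (t : T) : uniq l -> t \in l ->
  \sum_(x <- l) ind (t = x) = 1 :> R.
Proof.
move=> ul tl; rewrite (bigD1_seq t) //= ind1 // big1 ?addr0 // => x /eqP xt.
by rewrite ind0 // => /esym.
Qed.

End Expectation.

(** * Open paths, exits from a set, and finite clusters *)

Section Connectivity.
Context {V : countType} {adj : rel V}.
Implicit Types (w : config adj) (A B : set V) (e : edge adj) (s l : seq (edge adj)).

Definition joins e (x y : V) := val e = (x, y) \/ val e = (y, x).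

Definition touch A e : bool := `[< A (val e).1 \/ A (val e).2 >].

Definition off A w : config adj := fun e => w e && ~~ touch A e.

Definition mix A w w' : config adj := fun e => if touch A e then w' e else w e.

Definition restr l w : config adj := fun e => w e && (e \in l).

Definition join w w' : config adj := fun e => w e || w' e.

Definition connS w A B := exists a b, [/\ A a, B b & open_connected w a b].

Lemma joins_sym e x y : joins e x y -> joins e y x.
Proof. by case=> h; [right|left]. Qed.

Lemma touchl A e x y : joins e x y -> A x -> touch A e.
Proof. by move=> [] h Ax; apply/asboolP; rewrite h /=; [left|right]. Qed.

Lemma touchN A e x y : joins e x y -> ~ A x -> ~ A y -> ~~ touch A e.
Proof. by move=> h Ax Ay; apply/asboolP; case: h => -> /= []. Qed.

Lemma conn_refl w x : open_connected w x x.
Proof. exact: rt_refl. Qed.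

Lemma conn_trans w x y z :
  open_connected w x y -> open_connected w y z -> open_connected w x z.
Proof. exact: rt_trans. Qed.

Lemma conn_step w e x y : w e -> joins e x y -> open_connected w x y.
Proof. by move=> we h; apply: rt_step; exists e. Qed.

Lemma conn_sym w x y : open_connected w x y -> open_connected w y x.
Proof.
elim=> [u v [e [we h]]|u|u v z _ h1 _ h2].
- exact: conn_step we (joins_sym _ _ _ h).
- exact: conn_refl.
- exact: conn_trans h2 h1.
Qed.

(** A walk along open edges from [x] only consults edges at vertices already reached in [w], so
    nothing is asked of [w'] away from that cluster. *)
Lemma conn_transfer w w' x y :
  (forall z z' e, open_connected w x z -> w e -> joins e z z' -> w' e) ->
  open_connected w x y -> open_connected w' x y.
Proof.
move=> h /clos_rt_rtn1_iff; elim=> [|u v [e [we huv]] xu IH].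
  exact: conn_refl.
apply: conn_trans IH (conn_step _ e _ _ _ huv).
by apply: h huv => //; apply/clos_rt_rtn1_iff.
Qed.

Lemma conn_mono w w' x y : (forall e, w e -> w' e) ->
  open_connected w x y -> open_connected w' x y.
Proof. by move=> h; apply: conn_transfer => z z' e _ /h. Qed.

(** The exit edge itself may be open or closed: the list depends on [w] only through [off A w],
    which leaves the edges touching [A] free to be resampled. *)
Definition exits s A B w : seq (edge adj) :=
  [seq e <- s | `[< exists a u v, [/\ joins e a u, A a, ~ A u, B v
                                  & open_connected (off A w) u v] >]].

Lemma off_mix A w w' : off A (mix A w w') = off A w.
Proof.
by apply: funext => e; rewrite /off /mix; case: (touch A e); rewrite ?andbF.
Qed.

Lemma exits_mix s A B w w' : exits s A B (mix A w w') = exits s A B w.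
Proof. by rewrite /exits off_mix. Qed.

Lemma exits_touch s A B w e : e \in exits s A B w -> touch A e.
Proof.
by rewrite mem_filter => /andP[/asboolP[a [u [v [h Aa _ _ _]]]] _];
  apply: touchl h Aa.
Qed.

Lemma has_exits_connS s A B w : has w (exits s A B w) -> connS w A B.
Proof.
move=> /hasP[e]; rewrite mem_filter => /andP[/asboolP[a [u [v [h Aa Au Bv uv]]]] _] we.
exists a, v; split=> //; apply: conn_trans (conn_step _ _ _ _ we h) _.
by apply: conn_mono uv => f /andP[].
Qed.

(** Follow the path to its last vertex in [A]: the next edge is an open exit, because the rest of
    the path uses no edge touching [A]. *)
Lemma connS_has_exits s A B w : supp w s -> A `&` B = set0 ->
  connS w A B -> has w (exits s A B w).
Proof.
move=> sw AB [a [b [Aa Bb ab]]].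
have Ab : ~ A b by move=> Ab; have : (A `&` B) b by []; rewrite AB.
(* The induction runs from the [B] end: so far the path has avoided [A], or an open exit has been
   met. *)
suff : (~ A a /\ open_connected (off A w) a b) \/ has w (exits s A B w).
  by case=> // -[].
move/clos_rt_rt1n_iff: ab => ab; elim: {Aa} ab Bb Ab => [x|x y z [e [we h]] _ IH] Bz Az.
  by left; split=> //; apply: conn_refl.
have {IH}[[Ay yz]|?] := IH Bz Az; last by right.
have [Ax|Ax] := pselect (A x).
  right; apply/hasP; exists e => //; rewrite mem_filter sw // andbT.
  by apply/asboolP; exists x, y, z.
left; split=> //; apply: conn_trans (conn_step _ e _ _ _ h) yz.
by rewrite /off we (touchN _ _ _ _ h).
Qed.

Definition verts (x : V) l : seq V :=
  undup (x :: flatten [seq [:: (val e).1; (val e).2] | e <- l]).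

(** Filtering the fixed list [verts x l] makes clusters with the same members equal as lists, so the
    value of a cluster can be tested with [=]. *)
Definition Cl l (x : V) w : seq V :=
  [seq v <- verts x l | `[< open_connected (restr l w) x v >]].

Lemma Cl_uniq l x w : uniq (Cl l x w).
Proof. by rewrite filter_uniq // undup_uniq. Qed.

Lemma mem_Cl l x w v : v \in Cl l x w <-> open_connected (restr l w) x v.
Proof.
rewrite mem_filter; split=> [/andP[/asboolP]//|h].
apply/andP; split; first exact/asboolP.
rewrite mem_undup; move/clos_rt_rtn1_iff: h; elim=> [|u z [e [/andP[_ el] h]] _ _].
  by rewrite inE eqxx.
rewrite inE; apply/orP; right; apply/flattenP.
exists [:: (val e).1; (val e).2]; first by apply/mapP; exists e.
by case: h => ->; rewrite !inE eqxx ?orbT.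
Qed.

Lemma Cl_conn l x w v : v \in Cl l x w -> open_connected w x v.
Proof. by move/mem_Cl; apply: conn_mono => e /andP[]. Qed.

Lemma eq_Cl l x w w' :
  (forall v, v \in Cl l x w <-> v \in Cl l x w') -> Cl l x w = Cl l x w'.
Proof.
move=> h; rewrite /Cl; apply: eq_in_filter => v _.
by apply/asboolP/asboolP; rewrite -!mem_Cl => /h.
Qed.

(** Exploring the cluster of [x] inspects only edges with an endpoint in it, so the edges touching
    [a] decide whether the cluster is [a]. *)
Lemma Cl_local l x w w' a : (forall e, touch [set` a] e -> w e = w' e) ->
  Cl l x w = a -> Cl l x w' = a.
Proof.
move=> h ha; rewrite -[RHS]ha; apply: eq_Cl => v.
have E z z' e : open_connected (restr l w) x z -> joins e z z' ->
    restr l w e = restr l w' e.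
  by move=> /mem_Cl; rewrite ha => za hj; rewrite /restr h //; apply: touchl hj za.
rewrite !mem_Cl; split; last first.
  by apply: conn_transfer => z z' e xz we /(E _ _ _ xz) <-.
move/clos_rt_rtn1_iff; elim=> [|u z [e [we huz]] _ IH]; first exact: conn_refl.
by apply: conn_trans (IH) (conn_step _ e _ _ _ huz); rewrite (E _ _ _ IH huz).
Qed.

Lemma Cl_transfer l x w w' :
  (forall z z' e, open_connected w x z -> w e -> joins e z z' -> w' e) ->
  {subset Cl l x w <= Cl l x w'}.
Proof.
move=> h v /mem_Cl hv; apply/mem_Cl; apply: conn_transfer hv => z z' e xz.
move=> /andP[we el] hj; rewrite /restr el andbT; apply: h hj => //.
by apply: conn_mono xz => f /andP[].
Qed.

Lemma Cl_restr l x w : Cl l x (restr l w) = Cl l x w.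
Proof.
have E : restr l (restr l w) = restr l w.
  by apply: funext => e; rewrite /restr -andbA andbb.
by rewrite /Cl E.
Qed.

Lemma Cl_range l x : exists r : seq (seq V), uniq r /\ forall w, Cl l x w \in r.
Proof.
have [r [ur h]] := supp_range (seq V) l (Cl l x).
exists r; split=> // w; rewrite -Cl_restr; apply: h => e.
by rewrite /restr => /andP[].
Qed.

Lemma size_Cl_transfer l x w w' :
  (forall z z' e, open_connected w x z -> w e -> joins e z z' -> w' e) ->
  (size (Cl l x w) <= size (Cl l x w'))%N.
Proof. by move=> h; apply: uniq_leq_size (Cl_uniq _ _ _) (Cl_transfer _ _ _ _ h). Qed.

End Connectivity.

(** * Resampling and exit estimates on finitely many edges *)

Section FinitePercolation.
Context {R : realType} {V : countType} {adj : rel V}.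
Implicit Types (w : config adj) (A B : set V) (e : edge adj) (s l : seq (edge adj)).
Implicit Types (r : edge adj -> R).

Definition mixp A r r' : edge adj -> R :=
  fun e => if touch A e then r' e else r e.

Lemma mixpp A r : mixp A r r = r.
Proof. by apply: funext => e; rewrite /mixp; case: touch. Qed.

Lemma is_prob_mixp A r r' : is_prob r -> is_prob r' -> is_prob (mixp A r r').
Proof. by move=> h h' e; rewrite /mixp; case: touch. Qed.

Lemma Ex_mix A r r' s f :
  Ex r s (fun w => Ex r' s (fun w' => f (mix A w w'))) = Ex (mixp A r r') s f.
Proof.
apply: (Ex_combine (fun e b b' => if touch A e then b' else b)) => e.
  by case: touch.
by rewrite /mixp; case: touch => /=; ring.
Qed.

Lemma Ex_join r r' s f :
  Ex r s (fun w => Ex r' s (fun w' => f (join w w'))) =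
  Ex (fun e => r e + r' e - r e * r' e) s f.
Proof.
by apply: (Ex_combine (fun=> orb)) => e //=; ring.
Qed.

Lemma Ex_off A r r' s f : (forall w w', f (mix A w w') = f w) ->
  Ex (mixp A r r') s f = Ex r s f.
Proof.
move=> h; rewrite -Ex_mix; apply: Ex_eq => w _.
by rewrite -[RHS](Ex_cst r' s); apply: Ex_eq => w' _; rewrite h.
Qed.

(** Taking the edges touching [A] and the other edges from two independent copies does not change
    the law, and each factor then sees only one copy. *)
Lemma Ex_indep A r s f g : (forall w w', f (mix A w w') = f w) ->
  (forall w w', g (mix A w w') = g w') ->
  Ex r s (fun w => f w * g w) = Ex r s f * Ex r s g.
Proof.
move=> hf hg; rewrite -{1}(mixpp A r) -Ex_mix -ExZr; apply: Ex_eq => w _.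
by rewrite -ExZ; apply: Ex_eq => w' _; rewrite hf hg.
Qed.

Lemma Ex_no_open r s (F : pred (edge adj)) : uniq s ->
  Ex r s (fun w => ind (~ has w [seq e <- s | F e])) =
  \prod_(e <- s | F e) (1 - r e).
Proof.
move=> us; rewrite -Ex_all_false //; apply: Ex_eq => w _.
rewrite /ind; congr (_%:R : R); congr nat_of_bool.
apply/asboolP/allP => [h e es|h /hasP[e]].
  apply/implyP => Fe; apply/negP => we; apply: h; apply/hasP; exists e => //.
  by rewrite mem_filter Fe.
by rewrite mem_filter => /andP[Fe /h]; rewrite Fe => /negP.
Qed.

Lemma prod_ge_expr (c : R) r s (F : pred (edge adj)) : 0 <= c ->
  (forall e, c <= 1 - r e) ->
  c ^+ size [seq e <- s | F e] <= \prod_(e <- s | F e) (1 - r e).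
Proof.
move=> c0 h; elim: s => [|e s IH] /=; first by rewrite big_nil.
rewrite big_cons; case: (F e) => //=; rewrite exprS.
by apply: ler_pM => //; apply: exprn_ge0.
Qed.

Lemma prod_le_expr (q : R) r s (F : pred (edge adj)) :
  (forall e, F e -> q <= r e <= 1) ->
  \prod_(e <- s | F e) (1 - r e) <= (1 - q) ^+ size [seq e <- s | F e].
Proof.
move=> h; elim: s => [|e s IH] /=; first by rewrite big_nil.
rewrite big_cons; case: (boolP (F e)) => //= Fe; rewrite exprS.
have /andP[qr r1] := h e Fe.
apply: ler_pM => //; rewrite ?subr_ge0 ?lerB //.
by apply: prodr_ge0 => f /h /andP[_]; rewrite subr_ge0.
Qed.

(* Exits do not depend on the edges touching [A], which all have a fresh chance
   to be closed; [A] and [B] are disconnected exactly when all exits are closed. *)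
Lemma few_exits_bound (c : R) r s A B k : 0 <= c <= 1 -> is_prob r ->
  (forall e, c <= 1 - r e) -> uniq s -> A `&` B = set0 ->
  c ^+ k * Ex r s (fun w => ind (size (exits s A B w) < k)%N) <=
  Ex r s (fun w => ind (~ connS w A B)).
Proof.
move=> /andP[c0 c1] hr hc us AB; rewrite -ExZ -[in leRHS](mixpp A r) -Ex_mix.
apply: Ex_le => // w sw.
apply: (@le_trans _ _ (Ex r s (fun w' => ind (~ has w' (exits s A B w))))).
  rewrite Ex_no_open //; apply: le_trans (prod_ge_expr c _ _ _ c0 hc).
  case: (pselect (size (exits s A B w) < k)%N) => h; last first.
    by rewrite ind0 // mulr0 exprn_ge0.
  by rewrite ind1 // mulr1; apply: ler_wiXn2l => //; apply: ltnW.
apply: Ex_le => // w' sw'; apply: ind_le => h hc'; apply: h.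
have sm : supp (mix A w w') s.
  by move=> e; rewrite /mix; case: touch => [/sw'|/sw].
have /hasP[e] := connS_has_exits _ _ _ _ sm AB hc'.
rewrite exits_mix => he; rewrite /mix (exits_touch _ _ _ _ _ he) => we.
by apply/hasP; exists e.
Qed.

Lemma many_exits_bound (q : R) r s A B (v : config adj) k : is_prob r ->
  0 <= q <= 1 -> (forall e, touch A e -> q <= r e) -> uniq s ->
  Ex r s (fun w => ind (~ connS (join v w) A B /\
                        (k <= size (exits s A B (join v w)))%N)) <= (1 - q) ^+ k.
Proof.
move=> hr /andP[q0 q1] hq us; rewrite -(mixpp A r) -Ex_mix.
rewrite -[leRHS](Ex_cst r s); apply: Ex_le => // w _.
have E w' : join v (mix A w w') = mix A (join v w) (join v w').
  by apply: funext => e; rewrite /join /mix; case: touch.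
set F := exits s A B (join v w).
apply: (@le_trans _ _ (Ex r s (fun w' => ind (k <= size F)%N * ind (~ has w' F)))).
  apply: Ex_le => // w' _; rewrite E exits_mix -indM; apply: ind_le.
  move=> [h kF]; split=> // /hasP[e eF we]; apply: h.
  apply: (has_exits_connS s); apply/hasP; exists e; rewrite ?exits_mix //.
  by rewrite /mix (exits_touch _ _ _ _ _ eF) /join we orbT.
rewrite ExZ Ex_no_open //.
case: (pselect (k <= size F)%N) => kF; last first.
  by rewrite ind0 // mul0r exprn_ge0 // subr_ge0.
rewrite ind1 // mul1r; apply: le_trans (prod_le_expr q _ _ _ _) _.
  move=> e /asboolP[a [u [z [hj Aa _ _ _]]]]; have /andP[_ ->] := hr e.
  by rewrite hq //; apply: touchl hj Aa.
apply: ler_wiXn2l => //; lra.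
Qed.

Lemma thin_boundary_bound (c q eps : R) r s A B k : 0 < c <= 1 -> is_prob r ->
  (forall e, c <= 1 - r e) -> 0 <= q <= 1 -> uniq s -> A `&` B = set0 ->
  Ex r s (fun w => ind (~ connS w A B)) <= eps ->
  Ex (mixp A r (fun=> q)) s (fun w => ind (~ connS w A B)) <=
  c ^- k * eps + (1 - q) ^+ k.
Proof.
move=> /andP[c0 c1] hr hc hq us AB heps.
have hr' : is_prob (mixp A r (fun=> q)) by apply: is_prob_mixp.
apply: (@le_trans _ _ (Ex (mixp A r (fun=> q)) s (fun w =>
    ind (size (exits s A B w) < k)%N + ind (~ connS w A B /\
      (k <= size (exits s A B w))%N)))).
  apply: Ex_le => // w _; apply: ind_leD => h.
  by case: (ltnP (size (exits s A B w)) k); [left|right].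
rewrite ExD lerD //.
  (* Having few exits does not involve the edges touching [A], so its probability is the same before
     and after these edges are thinned. *)
  rewrite Ex_off; last by move=> w w'; rewrite exits_mix.
  rewrite ler_pdivlMl ?exprn_gt0 //; apply: le_trans heps.
  by apply: few_exits_bound => //; rewrite (ltW c0).
rewrite (_ : (fun w => _) = (fun w => ind (~ connS (join (fun=> false) w) A B /\
   (k <= size (exits s A B (join (fun=> false) w)))%N))) //.
by apply: many_exits_bound => // e; rewrite /mixp => ->.
Qed.

(** Let [A] be the cluster of [x] in [join w w']. It is unlikely to have fewer than [k] exits
    towards [B]: given [A = a], the edges of [w] not touching [a] are still fresh. Otherwise these
    exits, read backwards, lead from the vertices joined to [B] in [w] to [x], and [w'] leaves them
    all closed with probability at most [(1 - q) ^+ k]. *)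
Lemma Cl_split_bound (c q del : R) r rho s l (x : V) B n k : 0 < c <= 1 ->
  is_prob r -> (forall e, c <= 1 - r e) ->
  is_prob rho -> 0 <= q <= 1 -> (forall e, q <= rho e) -> uniq s -> 0 <= del ->
  (forall w', let a := Cl l x w' in (n <= size a)%N -> [set` a] `&` B = set0 ->
     Ex r s (fun w => ind (~ connS w [set` a] B)) <= del) ->
  Ex r s (fun w => Ex rho s (fun w' =>
    ind ((n <= size (Cl l x (join w w')))%N /\ ~ connS (join w w') [set x] B))) <=
  c ^- k * del + (1 - q) ^+ k.
Proof.
move=> /andP[c0 c1] hr hc hrho hq hqr us del0 H.
(* Attainability of [a] is recorded because the hypothesis only speaks of attained clusters. *)
pose few (a : seq V) w := [/\ [set` a] `&` B = set0, (n <= size a)%N,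
  exists w', a = Cl l x w' & (size (exits s [set` a] B w) < k)%N].
pose T w := [set u | exists2 v, B v & open_connected w u v].
apply: (@le_trans _ _ (Ex r s (fun w => Ex rho s (fun w' =>
   ind (few (Cl l x (join w w')) w) +
   ind (~ connS (join w w') (T w) [set x] /\
     (k <= size (exits s (T w) [set x] (join w w')))%N))))).
  apply: Ex_le => // w _; apply: Ex_le => // w' _; apply: ind_leD => -[nA xB].
  set A := Cl l x (join w w') in nA *.
  have TN z : open_connected (join w w') x z -> ~ T w z.
    move=> xz [v Bv zv]; apply: xB; exists x, v; split=> //.
    by apply: conn_trans xz _; apply: conn_mono zv => e; rewrite /join => ->.
  have TNA : forall z, z \in A -> ~ T w z by move=> z /Cl_conn; apply: TN.
  case: (ltnP (size (exits s [set` A] B w)) k) => hk; [left|right].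
    split=> //; last by exists (join w w').
    apply/seteqP; split=> // z [/= zA Bz].
    by apply: (TNA z) => //; exists z => //; apply: conn_refl.
  split.
    move=> [t [z [Tt -> tx]]]; apply: (TN t) => //; exact: conn_sym.
  (* An exit of [A] towards [B] ends in [T w], and the cluster of [x] avoids [T w]; reversed, it is
     an exit of [T w] towards [x]. *)
  apply: leq_trans hk _; rewrite !size_filter; apply: sub_count => e.
  move=> /asboolP[a [u [v [hj aA uA Bv uv]]]]; apply/asboolP.
  exists u, a, x; split=> //; first exact: joins_sym.
  - by exists v => //; apply: conn_mono uv => f /andP[].
  - exact: TNA.
  - apply: conn_sym; apply: conn_transfer (Cl_conn _ _ _ _ aA) => z z' f xz wf hf.
    rewrite /off wf (touchN _ _ _ _ hf) //; apply: TN => //.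
    by apply: conn_trans xz _; apply: conn_step wf hf.
have split_le : forall f g : config adj -> config adj -> R,
  Ex r s (fun w => Ex rho s (fun w' => f w w' + g w w')) =
  Ex r s (fun w => Ex rho s (f w)) + Ex r s (fun w => Ex rho s (g w)).
  by move=> f g; rewrite -ExD; apply: Ex_eq => w _; rewrite ExD.
rewrite split_le lerD //; last first.
  rewrite -[leRHS](Ex_cst r s); apply: Ex_le => // w _.
  exact: many_exits_bound.
(* The event [Cl l x _ = a] only involves edges touching [a], while [few a]
   only involves the others. *)
have [rg [urg hrg]] := Cl_range l x.
pose g a w := Ex rho s (fun w' => ind (Cl l x (join w w') = a)).
rewrite (_ : Ex r s _ = \sum_(a <- rg) Ex r s (fun w => ind (few a w) * g a w)).
  apply: (@le_trans _ _ (\sum_(a <- rg) c ^- k * del * Ex r s (g a))).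
    apply: ler_sum => a _.
    rewrite (Ex_indep [set` a]).
    - apply: ler_wpM2r.
        rewrite -(Ex_cst r s 0); apply: Ex_le => // w _.
        by rewrite -(Ex_cst rho s 0); apply: Ex_le => // w' _; apply: ind_ge0.
      case: (pselect ([/\ [set` a] `&` B = set0, (n <= size a)%N &
          exists w', a = Cl l x w'])) => [[aB na [w' aw']]|ha]; last first.
        rewrite (_ : Ex r s _ = 0).
          by rewrite mulr_ge0 // invr_ge0 exprn_ge0 // ltW.
        rewrite -[RHS](Ex_cst r s); apply: Ex_eq => w _.
        by apply: ind0 => -[? ? ? _]; apply: ha.
      rewrite ler_pdivlMl ?exprn_gt0 //.
      have := H w'; rewrite -aw' => /(_ na aB); apply: le_trans.
      apply: le_trans (few_exits_bound c _ _ _ _ k _ _ _ _ _) => //.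
        by rewrite ler_wpM2l ?exprn_ge0 ?(ltW c0) //; apply: Ex_le => // w _;
          apply: ind_le => -[].
      by rewrite (ltW c0).
    - by move=> w w'; rewrite /few exits_mix.
    - move=> w w'; apply: Ex_eq => v _; apply: ind_eq.
      by split; apply: Cl_local => e te; rewrite /join /mix te.
  rewrite -mulr_sumr -Ex_sum.
  rewrite (_ : Ex r s _ = 1) ?mulr1 // -[RHS](Ex_cst r s); apply: Ex_eq => w _.
  rewrite -Ex_sum -[RHS](Ex_cst rho s); apply: Ex_eq => w' _.
  exact: sum_ind_eq.
rewrite -Ex_sum; apply: Ex_eq => w _.
rewrite (_ : \sum_(a <- rg) _ = \sum_(a <- rg) Ex rho s
   (fun w' => ind (few a w) * ind (Cl l x (join w w') = a))); last first.
  by apply: eq_bigr => a _; rewrite ExZ.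
rewrite -Ex_sum; apply: Ex_eq => w' _.
(* Insert the factor 1 as the sum of the indicators of all values of the cluster. *)
rewrite -[LHS]mulr1 -(sum_ind_eq _ rg (Cl l x (join w w'))) // mulr_sumr.
apply: eq_bigr => a _; case: (pselect (Cl l x (join w w') = a)) => [->//|h].
by rewrite (ind0 _ h) !mulr0.
Qed.

End FinitePercolation.

(** * Joining a large cluster to a large cluster of lower density *)

Section Sprinkling.
Context {R : realType} {V : countType} {adj : rel V}.
Implicit Types (w : config adj) (s l : seq (edge adj)).

Lemma connS_sym w (A B : set V) : connS w A B -> connS w B A.
Proof.
by move=> [a [b [Aa Bb ab]]]; exists b, a; split=> //; apply: conn_sym.
Qed.

(** Condition on the cluster [b] of [y] in [w0]. Replacing the edges touching [b] by [w1] turns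
    [eps] into the bracket, by [thin_boundary_bound]; the bracket is the [del] of [Cl_split_bound],
    where the remaining sprinkling of rate at least [q2] joins the cluster of [x] to [b]. *)
Lemma two_clusters_bound (p0 q1 q2 eps : R) s l (x y : V) n k1 k2 :
  0 < p0 < 1 -> 0 <= q1 <= p0 -> 0 <= q2 <= 1 -> 0 <= eps -> uniq s ->
  (forall w1 w2, (n <= size (Cl l y w1))%N -> (n <= size (Cl l x w2))%N ->
     Ex (fun=> p0) s
       (fun w => ind (~ connS w [set` Cl l y w1] [set` Cl l x w2])) <= eps) ->
  Ex (fun=> p0) s (fun w0 => Ex (fun=> q1) s (fun w1 => Ex (fun=> q2) s (fun w2 =>
    ind [/\ (n <= size (Cl l y w0))%N,
            (n <= size (Cl l x (join (join w0 w1) w2)))%N &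
            ~ open_connected (join (join w0 w1) w2) x y]))) <=
  (1 - p0) ^- k2 * ((1 - p0) ^- k1 * eps + (1 - q1) ^+ k1) + (1 - q2) ^+ k2.
Proof.
move=> hp0 hq1 hq2 eps0 us H; set c := 1 - p0; set M := leRHS.
have hc : 0 < c <= 1 by rewrite /c; lra.
have hp0' : 0 <= p0 <= 1 by lra.
have hq1' : 0 <= q1 <= 1 by lra.
have P0 : is_prob (fun _ : edge adj => p0) by move=> e.
have P1 : is_prob (fun _ : edge adj => q1) by move=> e.
have P2 : is_prob (fun _ : edge adj => q2) by move=> e.
have cX k : 0 <= c ^- k by rewrite invr_ge0 exprn_ge0 //; lra.
have del0 : 0 <= c ^- k1 * eps + (1 - q1) ^+ k1.
  by rewrite addr_ge0 ?mulr_ge0 // exprn_ge0 //; lra.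
have M0 : 0 <= M by rewrite addr_ge0 ?mulr_ge0 // exprn_ge0 //; lra.
have [rg [urg hrg]] := Cl_range (adj := adj) l y.
pose G (b : seq V) (v v' : config adj) : R :=
  ind ((n <= size (Cl l x (join v v')))%N /\ ~ connS (join v v') [set x] [set` b]).
pose h (b : seq V) w0 : R := ind (Cl l y w0 = b /\ (n <= size b)%N).
(* Off [b] the sprinkling [w1] may be merged into [w2], so that the states of
   [w1] used by the two arguments of [G] sit on disjoint sets of edges. *)
pose Phi (b : seq V) w0 : R := Ex (fun=> q1) s (fun w1 => Ex (fun=> q2) s (fun w2 =>
  G b (mix [set` b] w0 w1) (mix [set` b] (join w1 w2) w2))).
apply: (@le_trans _ _ (Ex (fun=> p0) s (fun w0 => \sum_(b <- rg) Phi b w0 * h b w0))).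
  apply: Ex_le => // w0 _.
  rewrite (bigD1_seq (Cl l y w0)) //=.
  set b := Cl l y w0; rewrite -[leLHS]addr0; apply: lerD; last first.
    apply: sumr_ge0 => a _; rewrite mulr_ge0 ?ind_ge0 //.
    rewrite -(Ex_cst (fun=> q1) s 0); apply: Ex_le => // w1 _.
    by rewrite -(Ex_cst (fun=> q2) s 0); apply: Ex_le => // w2 _; apply: ind_ge0.
  rewrite -ExZr; apply: Ex_le => // w1 _; rewrite -ExZr; apply: Ex_le => // w2 _.
  rewrite -indM; apply: ind_le => -[nb nx xy]; split=> //.
  have bN z : open_connected (join (join w0 w1) w2) x z -> ~ z \in b.
    move=> xz /Cl_conn yz; apply: xy; apply: conn_trans xz _; apply: conn_sym.
    by apply: conn_mono yz => e; rewrite /join => ->.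
  split.
    (* On the bad event the cluster of [x] has no open edge touching [b], so discarding [w0] on
       those edges does not shrink it. *)
    apply: leq_trans nx _; apply: size_Cl_transfer => z z' e xz we hj.
    have /negbTE tN : ~~ touch [set` b] e.
      apply: touchN (hj) _ _; apply: bN => //.
      by apply: conn_trans xz _; apply: conn_step we hj.
    by move: we; rewrite /join /mix tN orbA.
  move=> [_ [z [-> zb xz]]]; apply: (bN z) => //.
  apply: conn_mono xz => e; rewrite /join /mix.
  by case: touch; case: (w0 e); case: (w1 e); case: (w2 e).
rewrite Ex_sum.
apply: (@le_trans _ _ (\sum_(b <- rg) M * Ex (fun=> p0) s
    (fun w0 => ind (Cl l y w0 = b)))); last first.
  rewrite -mulr_sumr -Ex_sum (_ : Ex _ s _ = 1) ?mulr1 //.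
  by rewrite -[RHS](Ex_cst (fun=> p0) s); apply: Ex_eq => w _; apply: sum_ind_eq.
apply: ler_sum => b _.
rewrite (Ex_indep [set` b]); last 2 first.
- move=> w w'; apply: Ex_eq => w1 _; apply: Ex_eq => w2 _; congr G.
  by apply: funext => e; rewrite /mix; case: touch.
- move=> w w'; apply: ind_eq.
  by split=> -[hb nb]; split=> //; apply: Cl_local hb => e te; rewrite /mix te.
have hh0 : 0 <= Ex (fun=> p0) s (h b).
  by rewrite -(Ex_cst (fun=> p0) s 0); apply: Ex_le => // w _; apply: ind_ge0.
have hle : Ex (fun=> p0) s (h b) <= Ex (fun=> p0) s (fun w0 => ind (Cl l y w0 = b)).
  by apply: Ex_le => // w _; apply: ind_le => -[].
case: (pselect ((n <= size b)%N /\ exists w, b = Cl l y w)) => [[nb [wb hb]]|Nb].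
  apply: le_trans (ler_wpM2l M0 hle); apply: ler_wpM2r => //.
  (* The law of the second argument of [G]: [w2] on edges touching [b], [join w1 w2] on the
     others. *)
  pose rho := mixp (R := R) (adj := adj) [set` b] (fun=> q1 + q2 - q1 * q2) (fun=> q2).
  have -> : Ex (fun=> p0) s (Phi b) = Ex (mixp [set` b] (fun=> p0) (fun=> q1)) s
      (fun v => Ex rho s (fun v' => G b v v')).
    rewrite -Ex_mix; apply: Ex_eq => w0 _.
    (* Split [w1] into independent copies: its edges touching [b] enter the first argument of [G],
       its other edges the second. *)
    rewrite /Phi -[in LHS](mixpp [set` b] (fun=> q1)) -Ex_mix Ex_exchange.
    apply: Ex_eq => w1 _.
    rewrite -(Ex_combine (fun e b1 b2 => if touch [set` b] e then b2 else b1 || b2)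
       (fun=> q1) (fun=> q2) rho); last 2 first.
    - by move=> e; case: touch.
    - by move=> e; rewrite /rho /mixp; case: touch => /=; ring.
    apply: Ex_eq => w1' _; apply: Ex_eq => w2 _.
    by congr G; apply: funext => e; rewrite /join /mix; case: touch.
  apply: Cl_split_bound => //.
  - exact: is_prob_mixp.
  (* Here [q1 <= p0] keeps every closing probability at least [1 - p0]. *)
  - by move=> e; rewrite /mixp /c; case: touch; lra.
  - by apply: is_prob_mixp => // e; nra.
  - by move=> e; rewrite /rho /mixp; case: touch; nra.
  move=> w' a na ab.
  rewrite (_ : Ex _ s _ = Ex (mixp [set` b] (fun=> p0) (fun=> q1)) s
     (fun w => ind (~ connS w [set` b] [set` a]))); last first.
    by apply: Ex_eq => w _; apply: ind_eq; split=> hN /connS_sym.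
  apply: thin_boundary_bound => //; first by rewrite setIC.
  by rewrite hb; apply: H => //; rewrite -hb.
rewrite (_ : Ex _ s (h b) = 0).
  rewrite mulr0 mulr_ge0 // -(Ex_cst (fun=> p0) s 0).
  by apply: Ex_le => // w _; apply: ind_ge0.
rewrite -[RHS](Ex_cst (fun=> p0) s); apply: Ex_eq => w _; apply: ind0 => -[hw nb].
by apply: Nb; split=> //; exists w.
Qed.

End Sprinkling.

(** * Continuity of probability and negligible sets *)

Section Continuity.
Context {R : realType} {d : measure_display} {T : measurableType d}.
Variable P : probability T R.

Lemma prob_bigcup_le (F : nat -> set T) (x : R) :
  (forall n, measurable (F n)) -> (forall n m, (n <= m)%N -> F n `<=` F m) ->
  (forall n, (P (F n) <= x%:E)%E) -> (P (\bigcup_n F n) <= x%:E)%E.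
Proof.
move=> mF hF h.
have mU : measurable (\bigcup_n F n) by apply: bigcup_measurable.
have hF' : {homo F : n m / (n <= m)%N >-> (n <= m)%O}.
  by move=> n m /hF ?; apply/subsetPset.
have c : P (F n) @[n --> \oo] --> P (\bigcup_n F n) := nondecreasing_cvg_mu mF mU hF'.
rewrite -(cvg_lim _ c) //; apply: lime_le; first by apply: cvgP c.
by apply: nearW.
Qed.

Lemma prob_bigcap_eventually (F : nat -> set T) (x y : R) :
  (forall n, measurable (F n)) -> (forall n m, (n <= m)%N -> F m `<=` F n) ->
  (P (\bigcap_n F n) <= x%:E)%E -> x < y ->
  exists n0, forall n, (n0 <= n)%N -> (P (F n) <= y%:E)%E.
Proof.
move=> mF hF hx xy; apply: contrapT => hN.
have mI : measurable (\bigcap_n F n) by apply: bigcap_measurable; [exists 0%N|].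
have hF' : {homo F : n m / (n <= m)%N >-> (m <= n)%O}.
  by move=> n m /hF ?; apply/subsetPset.
have F0 : (P (F 0%N) < +oo)%E.
  by apply: le_lt_trans (probability_le1 P (mF 0%N)) _; rewrite ltry.
have c : P (F n) @[n --> \oo] --> P (\bigcap_n F n) := nonincreasing_cvg_mu F0 mF mI hF'.
have : (y%:E <= P (\bigcap_n F n))%E.
  rewrite -(cvg_lim _ c) //; apply: lime_ge; first by apply: cvgP c.
  apply: nearW => n; apply/ltW; rewrite ltNge; apply/negP => hn.
  apply: hN; exists n => m nm; apply: le_trans hn.
  by apply: le_measure; rewrite ?inE //; apply: hF.
by move=> /le_trans /(_ hx); rewrite lee_fin leNgt xy.
Qed.

(** Intersect covers of probability at most [1 / (k + 1)]. No measurability of [N] itself is asked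
    for. *)
Lemma negligible_small_cover (N : set T) :
  (forall del : R, 0 < del -> exists M, [/\ measurable M, N `<=` M &
     (P M <= del%:E)%E]) -> P.-negligible N.
Proof.
move=> h.
have /choice[M hM] : forall k : nat, exists M, [/\ measurable M, N `<=` M &
     (P M <= (k.+1%:R^-1)%:E)%E] by move=> k; apply: h; rewrite invr_gt0 ltr0n.
exists (\bigcap_k M k); split.
- by apply: bigcap_measurable; [exists 0%N|move=> k _; case: (hM k)].
- apply/eqP; rewrite eq_le measure_ge0 andbT; apply/lee_addgt0Pr => e e0.
  rewrite add0e; have [k hk] : exists k : nat, k.+1%:R^-1 < e.
    exists (Num.truncn e^-1); rewrite -[ltRHS]invrK ltf_pV2 ?posrE ?invr_gt0 ?ltr0n //.
    exact: truncnS_gt.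
  case: (hM k) => mk _ lek; apply: le_trans (_ : (P (M k) <= _)%E).
    apply: le_measure; rewrite ?inE //.
      by apply: bigcap_measurable; [exists 0%N|move=> i _; case: (hM i)].
    exact: bigcap_inf.
  by apply: le_trans lek _; rewrite lee_fin ltW.
- by move=> w Nw k _; case: (hM k) => _ /(_ _ Nw).
Qed.

End Continuity.

(** * From the percolation measure to finite expectations *)

Section Cylinders.
Context {R : realType} {V : countType} {adj : rel V}.
Implicit Types (w : config adj) (s t l : seq (edge adj)).
Variables (p : R) (P : probability (Omega adj) R).
Hypothesis hP : is_bernoulli_percolation p P.

Lemma measurable_coord (e : edge adj) (b : bool) :
  measurable ([set w | w e = b] : set (Omega adj)).
Proof.
have mT : measurable ([set w | w e = true] : set (Omega adj)).
  by apply: sub_sigma_algebra; exists e.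
case: b => //; rewrite (_ : [set w | _] = ~` [set w : Omega adj | w e = true]).
  exact: measurableC.
by apply/seteqP; split=> w /=; case: (w e).
Qed.

Lemma measurable_cylinder s (tau : config adj) :
  measurable ([set w | forall e, e \in s -> w e = tau e] : set (Omega adj)).
Proof.
elim: s => [|e s IH].
  rewrite (_ : [set w | _] = [set: Omega adj]); first exact: measurableT.
  by apply/seteqP; split.
rewrite (_ : [set w | _] = [set w : Omega adj | w e = tau e] `&`
   [set w : Omega adj | forall e, e \in s -> w e = tau e]).
  by apply: measurableI => //; apply: measurable_coord.
apply/seteqP; split=> [w h|w [h1 h2] f].
  by split=> [|f fs]; apply: h; rewrite inE ?eqxx ?fs ?orbT.
by rewrite inE => /orP[/eqP->|/h2].
Qed.

Definition determined s (X : config adj -> Prop) :=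
  forall w w', (forall e, e \in s -> w e = w' e) -> X w -> X w'.

(** The edges of [t] are already revealed, with states [tau]. Revealing the head of [s] splits [Y]
    into two disjoint events, which reproduces the recursion of [Ex]. *)
Lemma prob_cylinder_Ex s t (tau : config adj) X :
  uniq (t ++ s) -> determined (t ++ s) X ->
  let Y := [set w : Omega adj | X w /\ forall e, e \in t -> w e = tau e] in
  measurable Y /\
  P Y = (\prod_(e <- t) (if tau e then p else 1 - p) *
         Ex (fun=> p) s (fun w => ind (X (fun e => if e \in t then tau e else w e))))%:E.
Proof.
elim: s t tau => [|e s IH] t tau.
  rewrite cats0 => ut dX Y; rewrite /=.
  set w0 := fun e : edge adj => if e \in t then tau e else false.
  have [Xw0|Xw0] := pselect (X w0).
    have -> : Y = [set w | forall e, e \in t -> w e = tau e].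
      apply/seteqP; split=> [w []//|w hw]; split=> //.
      by apply: dX Xw0 => e et; rewrite /w0 et hw.
    by split; [exact: measurable_cylinder|rewrite ind1 // mulr1; apply: hP].
  have -> : Y = set0.
    apply/seteqP; split=> // w [Xw hw]; apply: Xw0; apply: dX Xw => e et.
    by rewrite /w0 et hw.
  by rewrite ind0 // mulr0 measure0; split; [exact: measurable0|].
move=> uts dX Y.
have ets : (e \notin t) && (e \notin s).
  by move: uts; rewrite -cat_rcons cat_uniq rcons_uniq => /and3P[/andP[-> _] /hasPn h us];
    apply/negP => es; have := h _ es; rewrite mem_rcons inE eqxx.
case/andP: ets => et es.
have pm : perm_eq ((e :: t) ++ s) (t ++ e :: s).
  by rewrite -cat_rcons perm_cat2r perm_sym perm_rcons.
have uts' : uniq ((e :: t) ++ s) by rewrite (perm_uniq pm).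
have dX' : determined ((e :: t) ++ s) X.
  by move=> w w' h; apply: dX => f fts; apply: h; rewrite (perm_mem pm).
have [m1 e1] := IH _ (upd tau e true) uts' dX'.
have [m2 e2] := IH _ (upd tau e false) uts' dX'.
set Y1 := [set w | _] in m1 e1; set Y2 := [set w | _] in m2 e2.
have hY b : [set w : Omega adj | X w /\ forall f, f \in e :: t -> w f = upd tau e b f] =
   Y `&` [set w | w e = b].
  apply/seteqP; split=> [w [Xw h]|w [[Xw h] web]].
    split; last by rewrite /= h ?inE ?eqxx // /upd eqxx.
    split=> // f ft; rewrite h ?inE ?ft ?orbT // /upd; case: eqP => // fe.
    by rewrite fe (negbTE et) in ft.
  split=> // f; rewrite inE /upd => /orP[/eqP->|ft]; first by rewrite eqxx.
  by rewrite h //; case: eqP => // fe; rewrite fe (negbTE et) in ft.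
have EY : Y = Y1 `|` Y2.
  rewrite /Y1 /Y2 !hY; apply/seteqP; split=> [w Yw|w [[]|[]]//].
  by case E : (w e); [left|right].
split; first by rewrite EY; apply: measurableU.
have -> : P Y = (P Y1 + P Y2)%E.
  rewrite EY; apply: measureU => //.
  rewrite /Y1 /Y2 !hY; apply/seteqP; split=> // w [[_ /= h1] [_ /= h2]].
  by rewrite h1 in h2.
rewrite e1 e2 -EFinD; congr EFin.
have Eprod b : \prod_(f <- e :: t) (if upd tau e b f then p else 1 - p) =
   (if b then p else 1 - p) * \prod_(f <- t) (if tau f then p else 1 - p).
  rewrite big_cons {1}/upd eqxx; congr (_ * _); apply: eq_big_seq => f ft.
  by rewrite /upd; case: eqP => // fe; rewrite fe (negbTE et) in ft.
have EE b : Ex (fun=> p) s (fun w => ind (X (fun f =>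
      if f \in e :: t then upd tau e b f else w f))) =
    Ex (fun=> p) s (fun w => ind (X (fun f =>
      if f \in t then tau f else upd w e b f))).
  apply: Ex_eq => w _; congr (ind (X _)); apply: funext => f; rewrite inE /upd.
  by case: eqP => [->|] //=; rewrite (negbTE et).
by rewrite !Eprod !EE /=; ring.
Qed.

Lemma prob_restr s (X : config adj -> Prop) : uniq s ->
  measurable ([set w | X (restr s w)] : set (Omega adj)) /\
  P [set w | X (restr s w)] = (Ex (fun=> p) s (fun w => ind (X w)))%:E.
Proof.
move=> us; have dX : determined s (fun w => X (restr s w)).
  move=> w w' h; rewrite (_ : restr s w' = restr s w) //.
  by apply: funext => e; rewrite /restr; case: (boolP (e \in s)) => [/h->|]; rewrite ?andbF.
have [] := prob_cylinder_Ex s [::] (fun=> false) _ us dX.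
rewrite big_nil mul1r (_ : [set w : Omega adj | _ /\ _] = [set w | X (restr s w)]).
  move=> m ->; split=> //; congr EFin; apply: Ex_eq => w sw; congr (ind (X _)).
  apply: funext => e; rewrite /restr; case: (boolP (e \in s)) => es; rewrite ?andbT ?andbF //.
  by apply/esym/negP => /sw; rewrite (negbTE es).
by apply/seteqP; split=> w /= => [[]|].
Qed.

End Cylinders.

(** * Exhausting the graph by finite sets of edges *)

Section Exhaustion.
Context {V : countType} {adj : rel V}.
Implicit Types (w : config adj).

(** Several codes may decode to the same edge, hence [undup]. *)
Definition es (j : nat) : seq (edge adj) := undup (pmap unpickle (iota 0 j)).

Lemma es_uniq j : uniq (es j).
Proof. exact: undup_uniq. Qed.

Lemma mem_es (e : edge adj) j : (pickle e < j)%N -> e \in es j.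
Proof.
move=> h; rewrite mem_undup mem_pmap; apply/mapP; exists (pickle e).
  by rewrite mem_iota.
by rewrite pickleK.
Qed.

Lemma es_sub j j' : (j <= j')%N -> {subset es j <= es j'}.
Proof.
move=> jj' e; rewrite !mem_undup !mem_pmap => /mapP[i]; rewrite mem_iota => ij ->.
by apply/mapP; exists i => //; rewrite mem_iota /= (leq_trans ij).
Qed.

Lemma conn_es_mono w x y j j' : (j <= j')%N ->
  open_connected (restr (es j) w) x y -> open_connected (restr (es j') w) x y.
Proof.
move=> /es_sub h; apply: conn_mono => e; rewrite /restr => /andP[-> /h].
exact.
Qed.

Lemma conn_restr w l x y :
  open_connected (restr l w) x y -> open_connected w x y.
Proof. by apply: conn_mono => e /andP[]. Qed.

Lemma conn_es w x y : open_connected w x y ->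
  exists j, open_connected (restr (es j) w) x y.
Proof.
elim=> [u v [e [we h]]|u|u v z _ [j1 h1] _ [j2 h2]].
- exists (pickle e).+1; apply: conn_step h.
  by rewrite /restr we mem_es.
- by exists 0%N; apply: conn_refl.
- exists (maxn j1 j2).
  exact: conn_trans (conn_es_mono _ _ _ _ _ (leq_maxl _ _) h1)
    (conn_es_mono _ _ _ _ _ (leq_maxr _ _) h2).
Qed.

Lemma size_Cl_es x w j j' : (j <= j')%N ->
  (size (Cl (es j) x w) <= size (Cl (es j') x w))%N.
Proof.
move=> jj'; apply: uniq_leq_size (Cl_uniq _ _ _) _ => v /mem_Cl h.
by apply/mem_Cl; apply: conn_es_mono h.
Qed.

Lemma infinite_cluster_Cl w x n : infinite_set (Defs.cluster w x) ->
  exists j, (n <= size (Cl (es j) x w))%N.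
Proof.
move=> /(infinite_set_fset n)[B hB nB].
have [j hj] : exists j, {subset finmap.enum_fset B <= Cl (es j) x w}.
  have : forall v, v \in finmap.enum_fset B -> open_connected w x v by move=> v vB; apply: hB.
  elim: (finmap.enum_fset B) => [|v t IH] h; first by exists 0%N.
  have [j1 h1] := conn_es _ _ _ (h v (mem_head _ _)).
  have [z zt|j2 h2] := IH; first by apply: h; rewrite inE zt orbT.
  exists (maxn j1 j2) => z; rewrite inE => /orP[/eqP->|/h2/mem_Cl hz]; apply/mem_Cl.
    exact: conn_es_mono (leq_maxl _ _) h1.
  exact: conn_es_mono (leq_maxr _ _) hz.
by exists j; apply: leq_trans nB _; apply: uniq_leq_size hj; apply: finmap.fset_uniq.
Qed.

Lemma finite_cluster_Cl w x : ~ infinite_set (Defs.cluster w x) ->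
  exists n, forall j, (size (Cl (es j) x w) < n)%N.
Proof.
move=> /contrapT/finite_seqP[t ht]; exists (size t).+1 => j; rewrite ltnS.
apply: uniq_leq_size (Cl_uniq _ _ _) _ => v /Cl_conn h.
by have : Defs.cluster w x v by []; rewrite ht.
Qed.

End Exhaustion.

(** * Choice of parameters *)

Lemma expr_small (R : realType) (x eps : R) : 0 <= x < 1 -> 0 < eps ->
  exists k, x ^+ k <= eps.
Proof.
move=> /andP[x0 x1] eps0.
have /cvgr0Pnorm_le/(_ eps eps0)[k _ hk] : (x ^+ n @[n --> \oo] --> 0).
  by apply: cvg_expr; rewrite ger0_norm.
by exists k; apply: le_trans (hk k (leqnn k)); apply: ler_norm.
Qed.

Lemma sprinkling_parameters (R : realType) (p0 p : R) : 0 < p0 < 1 -> p0 < p <= 1 ->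
  exists q1 q2 : R, [/\ 0 < q1 <= p0, 0 < q2 <= 1 &
    p = (p0 + q1 - p0 * q1) + q2 - (p0 + q1 - p0 * q1) * q2].
Proof.
(* The cap [p0] is required by [two_clusters_bound]; the cap [(p - p0) / 2] leaves room for a
   positive [q2], which then solves [1 - p = (1 - p0) * (1 - q1) * (1 - q2)]. *)
move=> hp0 hp; pose q1 := Num.min p0 ((p - p0) / 2).
have q1p : q1 <= p0 by rewrite ge_min lexx.
have q1p' : q1 <= (p - p0) / 2 by rewrite ge_min lexx orbT.
have q10 : 0 < q1 by rewrite lt_min; apply/andP; split; lra.
pose c := (1 - p0) * (1 - q1).
have c0 : 0 < c by rewrite mulr_gt0 //; lra.
have cp : 1 - p < c by rewrite /c; nra.
exists q1, (1 - (1 - p) / c); split; first by rewrite q10.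
  apply/andP; split; first by rewrite subr_gt0 ltr_pdivrMr // mul1r.
  by rewrite gerBl divr_ge0 ?(ltW c0) //; lra.
have -> : p0 + q1 - p0 * q1 = 1 - c by rewrite /c; ring.
by field; rewrite gt_eqF.
Qed.

Lemma eventually_all (T : eqType) (l : seq T) (Q : T -> nat -> Prop) :
  (forall t, exists j0, forall j, (j0 <= j)%N -> Q t j) ->
  exists j0, forall j, (j0 <= j)%N -> forall t, t \in l -> Q t j.
Proof.
move=> h; elim: l => [|t l [j1 h1]]; first by exists 0%N.
have [j2 h2] := h t; exists (maxn j1 j2) => j; rewrite geq_max => /andP[j1j j2j] u.
by rewrite inE => /orP[/eqP->|ul]; [apply: h2|apply: h1].
Qed.

(** * Consequences of the two-set hypothesis at [p0] *)

Section TwoArm.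
Context {R : realType} {V : countType} {adj : rel V}.
Implicit Types (w : config adj).
Variables (p0 : R) (P0 : probability (Omega adj) R).
Hypothesis p0_01 : 0 < p0 < 1.
Hypothesis hP0 : is_bernoulli_percolation p0 P0.
Hypothesis V_infinite : infinite_set [set: V].
Hypothesis two_arm : forall eps : R, 0 < eps -> exists N : nat,
  forall A B : seq V, uniq A -> uniq B -> (N <= size A)%N -> (N <= size B)%N ->
    (P0 [set w : Omega adj | ~ connects w A B] <= eps%:E)%E.

Let P0_prob : is_prob (fun _ : edge adj => p0).
Proof. by move=> e; case/andP: p0_01 => h0 h1; rewrite !ltW. Qed.

Lemma measurable_finitary (Q : config adj -> Prop) :
  (forall w, Q w <-> exists j, Q (restr (es j) w)) ->
  measurable ([set w | Q w] : set (Omega adj)).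
Proof.
move=> h; rewrite (_ : [set w | Q w] =
  \bigcup_j [set w : Omega adj | Q (restr (es j) w)]).
  by apply: bigcup_measurable => j _; case: (prob_restr _ _ hP0 (es j) Q (es_uniq j)).
by apply/seteqP; split=> w /=; rewrite h => -[j]; exists j.
Qed.

Lemma connects_es (a b : seq V) w : connects w a b <->
  exists j, connects (restr (es j) w) a b.
Proof.
split=> [[x [y [xa [yb /conn_es[j h]]]]]|[j [x [y [xa [yb /conn_restr h]]]]]].
  by exists j, x, y.
by exists x, y.
Qed.

(** Disconnection inside [es j] decreases to disconnection in the whole graph. The size [N] is
    uniform, while [j0] depends on [a] and [b]; half of [eps] is spent on the limit. *)
Lemma two_arm_finite (eps : R) : 0 < eps -> exists N : nat, forall a b : seq V,
  uniq a -> uniq b -> (N <= size a)%N -> (N <= size b)%N ->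
  exists j0, forall j, (j0 <= j)%N ->
    Ex (fun=> p0) (es j) (fun w => ind (~ connS w [set` a] [set` b])) <= eps.
Proof.
move=> eps0; have [|N hN] := two_arm (eps / 2); first lra.
exists N => a b ua ub Na Nb.
pose F j := [set w : Omega adj | ~ connects (restr (es j) w) a b].
have hF j := prob_restr _ _ hP0 (es j) (fun w => ~ connects w a b) (es_uniq j).
have [||||j0 hj0] := prob_bigcap_eventually P0 F (eps / 2) eps.
- by move=> j; case: (hF j).
- move=> j j' jj' w /= h [x [y [xa [yb xy]]]]; apply: h; exists x, y; split=> //.
  by split=> //; apply: conn_es_mono xy.
- rewrite (_ : \bigcap_n F n = [set w : Omega adj | ~ connects w a b]).
    exact: hN.
  apply/seteqP; split=> [w h /connects_es[j]|w h j _ hj].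
    exact: h.
  by apply: h; apply/connects_es; exists j.
- lra.
exists j0 => j /hj0; case: (hF j) => _ ->; rewrite lee_fin; apply: le_trans.
apply: Ex_le => // w _; apply: ind_le => h [x [y [xa [yb xy]]]]; apply: h.
by exists x, y.
Qed.

(** At most [m] vertices have a code below [m], so among [m + N] vertices at least [N] are far. *)
Lemma far_vertices (m N : nat) : exists B : seq V,
  [/\ uniq B, (N <= size B)%N & forall v, v \in B -> (m <= pickle v)%N].
Proof.
have [B _ nB] := infinite_set_fset (m + N) V_infinite.
exists [seq v <- finmap.enum_fset B | (m <= pickle v)%N]; split.
- by rewrite filter_uniq // finmap.fset_uniq.
- rewrite size_filter -(leq_add2l m); apply: leq_trans nB _.
  rewrite -(count_predC (fun v => (m <= pickle v)%N)) addnC leq_add2r.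
  rewrite -size_filter -(size_map pickle) -[leqRHS](size_iota 0 m).
  apply: uniq_leq_size.
    by rewrite map_inj_uniq ?filter_uniq ?finmap.fset_uniq //;
      apply: (pcan_inj (@pickleK V)).
  move=> i /mapP[v]; rewrite mem_filter /= -ltnNge => /andP[h _] ->.
  by rewrite mem_iota.
- by move=> v; rewrite mem_filter => /andP[].
Qed.

Lemma finite_clusters_bounded w (Z : seq V) :
  (forall z, z \in Z -> ~ infinite_set (Defs.cluster w z)) ->
  exists m, forall z v, z \in Z -> (m <= pickle v)%N -> ~ open_connected w z v.
Proof.
elim: Z => [|z Z IH] h; first by exists 0%N.
have [y yZ|m1 h1] := IH; first by apply: h; rewrite inE yZ orbT.
have /contrapT/finite_seqP[t ht] := h z (mem_head _ _).
exists (maxn m1 (\max_(v <- t) pickle v).+1) => y v.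
rewrite geq_max inE => /orP[/eqP->|yZ] /andP[m1v tv]; last exact: h1.
move=> zv; have : Defs.cluster w z v by []; rewrite ht /= => vt.
by have := leq_bigmax_seq (F := pickle) v vt isT; rewrite leqNgt tv.
Qed.

(** A large set [Z] is joined with high probability to vertices of arbitrarily large code, which is
    impossible if all its clusters are finite. [Z] is chosen before [n], so a later threshold may
    depend on the size of [Z]. The window [es i] may exceed [es j], so that estimates can share one
    window. *)
Lemma large_cluster_seeds (del : R) : 0 < del -> exists Z : seq V,
  forall n, exists j0, forall i j, (j0 <= j)%N -> (j <= i)%N ->
    Ex (fun=> p0) (es i)
      (fun w => ind (forall z, z \in Z -> (size (Cl (es j) z w) < n)%N)) <= del.
Proof.
move=> del0; have [|N hN] := two_arm (del / 2); first lra.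
have [Z [uZ NZ _]] := far_vertices 0 N.
exists Z => n.
pose far m w := exists z v, [/\ z \in Z, (m <= pickle v)%N & open_connected w z v].
pose U m := [set w : Omega adj | ~ far m w].
have mU m : measurable (U m).
  rewrite (_ : U m = ~` [set w : Omega adj | far m w]) //.
  apply: measurableC; apply: measurable_finitary => w.
  split=> [[z [v [zZ mv /conn_es[j h]]]]|[j [z [v [zZ mv /conn_restr h]]]]].
    by exists j, z, v.
  by exists z, v.
have PU m : (P0 (U m) <= (del / 2)%:E)%E.
  have [B [uB NB hB]] := far_vertices m N.
  apply: le_trans (hN Z B uZ uB NZ NB); apply: le_measure; rewrite ?inE //.
    rewrite (_ : [set w | _] = ~` [set w : Omega adj | connects w Z B]) //.
    by apply: measurableC; apply: measurable_finitary => w; apply: connects_es.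
  by move=> w h [z [v [zZ [vB zv]]]]; apply: h; exists z, v; split=> //; apply: hB.
pose W i := [set w : Omega adj | forall z, z \in Z -> (size (Cl (es i) z w) < n)%N].
have EW i j : (j <= i)%N -> measurable (W j) /\ P0 (W j) = (Ex (fun=> p0) (es i)
      (fun w => ind (forall z, z \in Z -> (size (Cl (es j) z w) < n)%N)))%:E.
  move=> ji; have := prob_restr _ _ hP0 (es i)
    (fun w => forall z, z \in Z -> (size (Cl (es j) z w) < n)%N) (es_uniq i).
  rewrite (_ : [set w : Omega adj | forall z, _ -> _] = W j) //.
  have E w z : Cl (es j) z (restr (es i) w) = Cl (es j) z w.
    rewrite -[LHS]Cl_restr -[RHS]Cl_restr; congr Cl; apply: funext => e.
    rewrite /restr; case: (boolP (e \in es j)) => [/(es_sub _ _ ji)->|_].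
      by rewrite andbT.
    by rewrite !andbF.
  by apply/seteqP; split=> w h z zZ; [rewrite -E|rewrite E]; apply: h.
have [||||j0 hj0] := prob_bigcap_eventually P0 W (del / 2) del.
- by move=> j; case: (EW j j (leqnn j)).
- by move=> i j ij w h z zZ; apply: leq_ltn_trans (h z zZ); apply: size_Cl_es.
(* Clusters of size below [n] in every window are finite, so together they miss all vertices beyond
   some code [m]. *)
- apply: (@le_trans _ _ (P0 (\bigcup_m U m))).
    apply: le_measure; rewrite ?inE.
    + apply: bigcap_measurable; first by exists 0%N.
      by move=> j _; case: (EW j j (leqnn j)).
    + exact: bigcup_measurable.
    move=> w hw; have [|m hm] := finite_clusters_bounded w Z.
      move=> z zZ /(infinite_cluster_Cl _ _ n)[j].
      by rewrite leqNgt (hw j I z zZ).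
    by exists m => // -[z [v [zZ mv]]]; apply: hm.
  apply: prob_bigcup_le => // m m' mm' w h [z [v [zZ mv zv]]]; apply: h.
  by exists z, v; split=> //; apply: leq_trans mv.
- lra.
exists j0 => i j j0j ji; have [_ E] := EW i j ji; rewrite -lee_fin -E; exact: hj0.
Qed.

End TwoArm.

(** * Existence and uniqueness of the infinite cluster above [p0] *)

Section Uniqueness.
Context {R : realType} {V : countType} {adj : rel V}.
Implicit Types (w : config adj).
Variables (p0 p : R) (P0 P1 : probability (Omega adj) R).
Hypothesis p0_01 : 0 < p0 < 1.
Hypothesis p0_p1 : p0 < p <= 1.
Hypothesis hP0 : is_bernoulli_percolation p0 P0.
Hypothesis hP1 : is_bernoulli_percolation p P1.
Hypothesis V_infinite : infinite_set [set: V].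
Hypothesis two_arm : forall eps : R, 0 < eps -> exists N : nat,
  forall A B : seq V, uniq A -> uniq B -> (N <= size A)%N -> (N <= size B)%N ->
    (P0 [set w : Omega adj | ~ connects w A B] <= eps%:E)%E.

Lemma two_clusters_small (q1 q2 del : R) (x : V) : 0 < q1 <= p0 -> 0 < q2 <= 1 ->
  0 < del -> exists n, forall (z : V) j, exists i0, forall i, (i0 <= i)%N ->
  Ex (fun=> p0) (es i) (fun w0 => Ex (fun=> q1) (es i) (fun w1 =>
  Ex (fun=> q2) (es i) (fun w2 =>
    ind [/\ (n <= size (Cl (es j) z w0))%N,
            (n <= size (Cl (es j) x (join (join w0 w1) w2)))%N &
            ~ open_connected (join (join w0 w1) w2) x z]))) <= del.
Proof.
move=> hq1 hq2 del0; have hp0 := p0_01.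
have c0 k : 0 < (1 - p0) ^+ k by rewrite exprn_gt0 //; lra.
(* Order of choice: [k2] first, then [k1] to absorb the factor [(1 - p0) ^- k2], then [eps] to
   absorb both such factors; each of the three terms is at most [del / 3]. *)
have [||k2 hk2] := expr_small R (1 - q2) (del / 3); [lra|lra|].
have [||k1 hk1] := expr_small R (1 - q1) ((1 - p0) ^+ k2 * (del / 3)); first lra.
  by rewrite mulr_gt0 //; lra.
pose eps := (1 - p0) ^+ k1 * ((1 - p0) ^+ k2 * (del / 3)).
have eps0 : 0 < eps by rewrite !mulr_gt0 //; lra.
have [N hN] := two_arm_finite p0 P0 p0_01 hP0 two_arm eps eps0.
exists N => z j.
(* The two clusters in [es j] take finitely many values, so one [i0] serves all pairs. *)
have [rz [_ hrz]] := Cl_range (adj := adj) (es j) z.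
have [rx [_ hrx]] := Cl_range (adj := adj) (es j) x.
pose Q (a b : seq V) i := uniq a -> uniq b -> (N <= size a)%N -> (N <= size b)%N ->
  Ex (fun=> p0) (es (adj := adj) i) (fun w => ind (~ connS w [set` a] [set` b])) <= eps.
have hQ a b : exists i0, forall i, (i0 <= i)%N -> Q a b i.
  case: (pselect [/\ uniq a, uniq b, (N <= size a)%N & (N <= size b)%N]).
    by move=> [ua ub Na Nb]; have [i0 h] := hN a b ua ub Na Nb;
    exists i0 => i i0i _ _ _ _; apply: h.
  by move=> h; exists 0%N => i _ ua ub Na Nb; exfalso; apply: h.
have [i0 hi0] := eventually_all _ rz (fun a i => forall b, b \in rx -> Q a b i)
  (fun a => eventually_all _ rx (fun b i => Q a b i) (hQ a)).
exists i0 => i i0i.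
apply: le_trans (two_clusters_bound p0 q1 q2 eps _ _ _ _ _ k1 k2 p0_01 _ _ _ _ _) _.
- lra.
- lra.
- exact: ltW.
- exact: es_uniq.
- by move=> w1 w2 nz nx; apply: hi0 => //; apply: Cl_uniq.
have -> : (1 - p0) ^- k1 * eps = (1 - p0) ^+ k2 * (del / 3).
  by rewrite /eps mulKf // gt_eqF.
have : (1 - p0) ^- k2 * ((1 - p0) ^+ k2 * (del / 3) + (1 - q1) ^+ k1) <=
  del / 3 + del / 3; last lra.
by rewrite ler_pdivrMl // mulrDr lerD2l.
Qed.

Lemma Ex_monotone (q q' : R) s (f : config adj -> R) : 0 <= q <= 1 -> 0 <= q' <= 1 ->
  (forall w w', f (join w w') <= f w) ->
  Ex (fun=> q + q' - q * q') s f <= Ex (fun=> q) s f.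
Proof.
move=> hq hq' hf; rewrite -(Ex_join (fun=> q) (fun=> q')).
have Pq : is_prob (fun _ : edge adj => q) by [].
have Pq' : is_prob (fun _ : edge adj => q') by [].
apply: Ex_le => // w _; rewrite -[leRHS](Ex_cst (fun=> q') s).
by apply: Ex_le => // w' _; apply: hf.
Qed.

(** Some seed [z] in [Z] has a large cluster already at density [p0]. If [x] and [y] are not joined,
    one of them is not joined to [z], which [two_clusters_small] makes unlikely. *)
Lemma two_large_clusters_small (x y : V) (del : R) : 0 < del -> exists n j0,
  forall j, (j0 <= j)%N -> exists i, (j <= i)%N /\
  Ex (fun=> p) (es i) (fun w => ind [/\ (n <= size (Cl (es j) x w))%N,
    (n <= size (Cl (es j) y w))%N & ~ open_connected w x y]) <= del.
Proof.
move=> del0; have hp0 := p0_01; have [q1 [q2 [hq1 hq2 Ep]]] := sprinkling_parameters _ _ _ p0_01 p0_p1.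
have [|Z hZ] := large_cluster_seeds p0 P0 hP0 V_infinite two_arm (del / 2); first lra.
pose K : R := (size Z).+1%:R.
have K0 : 0 < K by rewrite ltr0n.
(* Two bad events for each seed cost at most [2 * K * del' = del / 2]; the successor in [K] covers
   an empty [Z]. *)
pose del' := del / (4 * K).
have del'0 : 0 < del' by rewrite divr_gt0 // mulr_gt0.
have [n1 h1] := two_clusters_small _ _ _ x hq1 hq2 del'0.
have [n2 h2] := two_clusters_small _ _ _ y hq1 hq2 del'0.
pose n := maxn n1 n2; have [j0 hj0] := hZ n.
exists n, j0 => j j0j.
have [i1 hi1] := eventually_all _ Z _ (fun z => h1 z j).
have [i2 hi2] := eventually_all _ Z _ (fun z => h2 z j).
pose i := maxn j (maxn i1 i2); exists i; split; first exact: leq_maxl.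
have i1i : (i1 <= i)%N by rewrite /i !leq_max leqnn orbT.
have i2i : (i2 <= i)%N by rewrite /i !leq_max leqnn !orbT.
have Pr0 : is_prob (fun _ : edge adj => p0) by move=> e; apply/andP; split; lra.
have Pr1 : is_prob (fun _ : edge adj => q1) by move=> e; apply/andP; split; lra.
have Pr2 : is_prob (fun _ : edge adj => q2) by move=> e; apply/andP; split; lra.
set l := es j; set s := es i.
rewrite Ep -(Ex_join (fun=> p0 + q1 - p0 * q1) (fun=> q2)).
rewrite -(Ex_join (fun=> p0) (fun=> q1) s (fun w => Ex (fun=> q2) s _)).
pose bad m (v z : V) w0 w1 w2 : R :=
  ind [/\ (m <= size (Cl l z w0))%N, (m <= size (Cl l v (join (join w0 w1) w2)))%N &
          ~ open_connected (join (join w0 w1) w2) v z].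
apply: (@le_trans _ _ (Ex (fun=> p0) s (fun w0 => Ex (fun=> q1) s (fun w1 =>
  Ex (fun=> q2) s (fun w2 =>
    ind (forall z, z \in Z -> (size (Cl l z w0) < n)%N) +
    \sum_(z <- Z) (bad n1 x z w0 w1 w2 + bad n2 y z w0 w1 w2)))))).
  apply: Ex_le => // w0 _; apply: Ex_le => // w1 _; apply: Ex_le => // w2 _.
  set w := join (join w0 w1) w2.
  have S0 : 0 <= \sum_(z <- Z) (bad n1 x z w0 w1 w2 + bad n2 y z w0 w1 w2).
    by apply: sumr_ge0 => z _; rewrite addr_ge0 ?ind_ge0.
  case: (pselect (forall z, z \in Z -> (size (Cl l z w0) < n)%N)) => hz.
    by rewrite (ind1 _ hz) -[leLHS]addr0 lerD ?ind_le1.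
  have [z zZ nz] : exists2 z, z \in Z & (n <= size (Cl l z w0))%N.
    apply: contrapT => hN; apply: hz => z zZ; rewrite ltnNge; apply/negP => nz.
    by apply: hN; exists z.
  rewrite (ind0 _ hz) add0r.
  apply: (@le_trans _ _ (bad n1 x z w0 w1 w2 + bad n2 y z w0 w1 w2)); last first.
    rewrite (perm_big _ (perm_to_rem zZ)) big_cons lerDl; apply: sumr_ge0 => z' _.
    by rewrite addr_ge0 ?ind_ge0.
  apply: ind_leD => -[nx ny xy].
  have le1 : (n1 <= n)%N by apply: leq_maxl.
  have le2 : (n2 <= n)%N by apply: leq_maxr.
  case: (pselect (open_connected w x z)) => xz.
    right; split; [exact: leq_trans nz|exact: leq_trans ny|].
    by move=> yz; apply: xy; apply: conn_trans xz (conn_sym _ _ _ yz).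
  by left; split; [exact: leq_trans nz|exact: leq_trans nx|].
have E' f g : Ex (fun=> p0) s (fun w0 => Ex (fun=> q1) s (fun w1 =>
    Ex (fun=> q2) s (fun w2 => f w0 w1 w2 + g w0 w1 w2))) =
    Ex (fun=> p0) s (fun w0 => Ex (fun=> q1) s (fun w1 => Ex (fun=> q2) s (f w0 w1))) +
    Ex (fun=> p0) s (fun w0 => Ex (fun=> q1) s (fun w1 => Ex (fun=> q2) s (g w0 w1))).
  rewrite -ExD; apply: Ex_eq => w0 _; rewrite -ExD; apply: Ex_eq => w1 _.
  by rewrite ExD.
have E f g : Ex (fun=> p0) s (fun w0 => Ex (fun=> q1) s (fun w1 =>
    Ex (fun=> q2) s (fun w2 => f w0 + g w0 w1 w2))) =
    Ex (fun=> p0) s f + Ex (fun=> p0) s (fun w0 => Ex (fun=> q1) s (fun w1 =>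
    Ex (fun=> q2) s (fun w2 => g w0 w1 w2))).
  rewrite (E' (fun w0 _ _ => f w0)); congr (_ + _); apply: Ex_eq => w0 _.
  by rewrite -[RHS](Ex_cst (fun=> q1) s); apply: Ex_eq => w1 _; rewrite Ex_cst.
rewrite E (_ : del = del / 2 + del / 2); last by field.
apply: lerD; first by apply: hj0 => //; apply: leq_maxl.
rewrite (_ : Ex _ _ _ = \sum_(z <- Z) Ex (fun=> p0) s (fun w0 => Ex (fun=> q1) s
  (fun w1 => Ex (fun=> q2) s (fun w2 => bad n1 x z w0 w1 w2 + bad n2 y z w0 w1 w2)))).
  apply: (@le_trans _ _ (\sum_(z <- Z) (del' + del'))).
    rewrite big_seq [leRHS]big_seq; apply: ler_sum => z zZ; rewrite E'; apply: lerD.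
      exact: hi1.
    exact: hi2.
  rewrite big_const_seq count_predT iter_addr_0 -[leLHS]mulr_natr.
  apply: (@le_trans _ _ ((del' + del') * K)).
    by apply: ler_wpM2l; [lra|rewrite ler_nat].
  by rewrite le_eqVlt; apply/orP; left; apply/eqP; rewrite /del'; field; rewrite gt_eqF.
rewrite -Ex_sum; apply: Ex_eq => w0 _; rewrite -Ex_sum; apply: Ex_eq => w1 _.
by rewrite -Ex_sum.
Qed.

Lemma two_infinite_clusters_negligible (x y : V) :
  P1.-negligible [set w : Omega adj | [/\ infinite_set (Defs.cluster w x),
    infinite_set (Defs.cluster w y) & ~ open_connected w x y]].
Proof.
apply: negligible_small_cover => del del0.
have [n [j0 h]] := two_large_clusters_small x y del del0.
pose big j w := (n <= size (Cl (es j) x w))%N /\ (n <= size (Cl (es j) y w))%N.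
pose G j := [set w : Omega adj | big j w /\ ~ open_connected w x y].
have mG j : measurable (G j).
  rewrite (_ : G j = [set w : Omega adj | big j (restr (es j) w)] `&`
    ~` [set w : Omega adj | open_connected w x y]); last first.
    by apply/seteqP; split=> w; rewrite /= /big !Cl_restr.
  apply: measurableI.
    by have [] := prob_restr _ _ hP1 (es j) (big j) (es_uniq j).
  apply: measurableC; apply: (measurable_finitary _ _ hP1) => w.
  by split=> [/conn_es//|[i /conn_restr]].
have hG i j : (i <= j)%N -> G i `<=` G j.
  move=> ij w [[hx hy] xy]; split=> //.
  by split; [apply: leq_trans hx _|apply: leq_trans hy _]; apply: size_Cl_es.
exists (\bigcup_j G j); split; first exact: bigcup_measurable.
  move=> w [/(infinite_cluster_Cl _ _ n)[j1 h1] /(infinite_cluster_Cl _ _ n)[j2 h2] xy].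
  exists (maxn j1 j2) => //; split=> //; split.
    by apply: leq_trans h1 _; apply: size_Cl_es; apply: leq_maxl.
  by apply: leq_trans h2 _; apply: size_Cl_es; apply: leq_maxr.
apply: prob_bigcup_le => // j.
have [i [ji hi]] := h (maxn j0 j) (leq_maxl _ _).
(* The estimate starts at [j0], so the increasing event [G j] is first enlarged to [G j']. *)
set j' := maxn j0 j in ji hi.
have [m E] := prob_restr _ _ hP1 (es i) (fun w => [/\ (n <= size (Cl (es j') x w))%N,
  (n <= size (Cl (es j') y w))%N & ~ open_connected w x y]) (es_uniq i).
apply: (@le_trans _ _ (P1 (G j'))).
  by apply: le_measure; rewrite ?inE //; apply: hG; apply: leq_maxr.
rewrite -lee_fin -E in hi; apply: le_trans hi.
apply: le_measure; rewrite ?inE // => w [[hx hy] xy].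
have C v : (size (Cl (es j') v w) <= size (Cl (es j') v (restr (es i) w)))%N.
  apply: uniq_leq_size (Cl_uniq _ _ _) _ => u /mem_Cl hu; apply/mem_Cl.
  apply: conn_mono hu => e; rewrite /restr => /andP[-> ej]; rewrite ej andbT /=.
  exact: es_sub ej.
split; [exact: leq_trans (C x)|exact: leq_trans (C y)|].
by move=> /conn_restr.
Qed.

(** If all clusters are finite, those of the finite set [Z] have a common size bound [n]. Such
    smallness is a decreasing event, so its [p0] estimate carries over to [p]. *)
Lemma no_infinite_cluster_negligible :
  P1.-negligible [set w : Omega adj | forall x, ~ infinite_set (Defs.cluster w x)].
Proof.
apply: negligible_small_cover => del del0.
have [Z hZ] := large_cluster_seeds p0 P0 hP0 V_infinite two_arm del del0.
pose small n j w := forall z, z \in Z -> (size (Cl (es j) z w) < n)%N.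
pose U n := \bigcap_j [set w : Omega adj | small n j w].
have mS n j : measurable [set w : Omega adj | small n j w] /\
    P1 [set w : Omega adj | small n j w] = (Ex (fun=> p) (es j) (fun w => ind (small n j w)))%:E.
  have := prob_restr _ _ hP1 (es j) (small n j) (es_uniq j).
  rewrite (_ : [set w | _] = [set w : Omega adj | small n j w]) //.
  by apply/seteqP; split=> w h z; have := h z; rewrite Cl_restr.
have mU n : measurable (U n).
  by apply: bigcap_measurable; [exists 0%N|move=> j _; case: (mS n j)].
exists (\bigcup_n U n); split; first exact: bigcup_measurable.
  move=> w hw.
  suff [n hn] : exists n, forall j, small n j w by exists n => // j _; apply: hn.
  rewrite /small; elim: (Z) => [|z Z' [n1 h1]]; first by exists 0%N.
  have [n2 h2] := finite_cluster_Cl _ _ (hw z).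
  exists (maxn n1 n2) => j u; rewrite inE leq_max => /orP[/eqP->|/h1->//].
  by rewrite h2 orbT.
apply: prob_bigcup_le => //.
  by move=> n n' nn' w h j jT z zZ; apply: leq_trans nn'; apply: h.
move=> n; have [j0 /(_ j0 j0 (leqnn _) (leqnn _)) hj0] := hZ n.
have [m E] := mS n j0.
apply: (@le_trans _ _ (P1 [set w : Omega adj | small n j0 w])).
  by apply: le_measure; rewrite ?inE // => w /(_ j0 I).
rewrite E lee_fin; apply: le_trans hj0.
have hp0 := p0_01; have hp := p0_p1.
(* The sprinkling rate that raises density [p0] to [p]. *)
pose q := (p - p0) / (1 - p0).
have hq : 0 <= q <= 1.
  by rewrite divr_ge0 ?ler_pdivrMr /=; lra.
rewrite (_ : p = p0 + q - p0 * q); last by rewrite /q; field; rewrite gt_eqF; lra.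
apply: Ex_monotone => //; first by apply/andP; split; lra.
move=> w w'; apply: ind_le => h z zZ; apply: leq_ltn_trans (h z zZ).
by apply: size_Cl_transfer => u u' e _ we _; rewrite /join we.
Qed.

End Uniqueness.

Theorem theorem1p9 (R : realType) (V : countType) (adj : rel V)
  (adj_sym : symmetric adj) (adj_irr : irreflexive adj)
  (V_infinite : infinite_set [set: V])
  (G_connected : forall x y : V, clos_refl_trans V (fun a b => adj a b) x y)
  (G_bounded_degree : exists D : nat, forall (x : V) (s : seq V),
      uniq s -> all (adj x) s -> (size s <= D)%N)
  (P : R -> probability (Omega adj) R)
  (P_bernoulli : forall p : R, 0 <= p <= 1 -> is_bernoulli_percolation p (P p))
  (p0 : R) (p0_pos : 0 < p0) (p0_lt1 : p0 < 1)
  (H_two_arm : forall eps : R, 0 < eps -> exists N : nat,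
      forall A B : seq V, uniq A -> uniq B -> (N <= size A)%N -> (N <= size B)%N ->
        (P p0 [set w : Omega adj | ~ connects w A B] <= eps%:E)%E) :
  forall p : R, p0 < p -> p <= 1 ->
    {ae P p, forall w : Omega adj, unique_infinite_cluster w}.
Proof.
move=> p p0p p1.
have hP0 : is_bernoulli_percolation p0 (P p0) by apply: P_bernoulli; lra.
have hP1 : is_bernoulli_percolation p (P p) by apply: P_bernoulli; lra.
have p0_01 : 0 < p0 < 1 by rewrite p0_pos.
have p0_p1 : p0 < p <= 1 by rewrite p0p.
(* Pairs of vertices are enumerated by their codes, to get a countable union; codes of no pair give
   the empty event. *)
pose bad (k : nat) : set (Omega adj) :=
  if @unpickle (V * V)%type k is Some (x, y) then
    [set w : Omega adj | [/\ infinite_set (Defs.cluster w x),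
      infinite_set (Defs.cluster w y) & ~ open_connected w x y]] else set0.
have nbad : (P p).-negligible (\bigcup_k bad k).
  apply: negligible_bigcup => k; rewrite /bad; case: unpickle => [[x y]|].
    exact: (two_infinite_clusters_negligible p0 p (P p0)).
  exact: negligible_set0.
apply: negligibleS (negligibleU (no_infinite_cluster_negligible p0 p (P p0) (P p)
  p0_01 p0_p1 hP0 hP1 V_infinite H_two_arm) nbad) => w /= hw.
apply: contrapT => hN; apply: hw; split.
  apply: contrapT => h; apply: hN; left => x hx; apply: h; by exists x.
move=> x y hx hy; apply: contrapT => xy; apply: hN; right.
by exists (pickle (x, y)) => //; rewrite /bad pickleK.
Qed.
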